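(* Let $R$ be a ring, $\Sigma=\{\sigma_1,\dots,\sigma_n\}$ a finite family of injective endomorphisms of $R$, and $\Delta=\{\delta_1,\dots,\delta_n\}$ a family of maps such that $\delta_i$ is a $\sigma_i$-derivation of $R$ for each $i$. Suppose that $R$ is $\Sigma$-semicommutative and Baer. Then for all $\alpha,\beta\in\mathbb{N}^n$, every $1\le i\le n$, and every nonempty subset $S$ of $R$, the following assertions hold: (1) $l_R(S)=l_R(\sigma^\alpha(S))$. (2) $l_R(S)\subseteq l_R(\delta^\beta(S))$. (3) $\sigma_i(l_R(S))\subseteq l_R(S)$. (4) $\delta_i(l_R(S))\subseteq l_R(S)$.
   Context: Rings are associative with identity; $\mathbb{N}$ includes $0$. Endomorphisms are additive and multiplicative, and are not required a priori to preserve $1$. A $\sigma_i$-derivation is an additive map $\delta_i:R\to R$ with $\delta_i(rs)=\sigma_i(r)\delta_i(s)+\delta_i(r)s$ for all $r,s\in R$. For $\alpha=(\alpha_1,\dots,\alpha_n)\in\mathbb{N}^n$, $\sigma^\alpha:=\sigma_1^{\alpha_1}\circ\cdots\circ\sigma_n^{\alpha_n}$ and $\delta^\alpha:=\delta_1^{\alpha_1}\circ\cdots\circ\delta_n^{\alpha_n}$. For a subset $S\subseteq R$, $l_R(S)=\{r\in R\mid rs=0 \text{ for all } s\in S\}$. $R$ is $\Sigma$-semicommutative if for all $a,b\in R$, $ab=0$ implies $aR\sigma^\alpha(b)=0$ for every $\alpha\in\mathbb{N}^n\setminus\{0\}$. A ring is Baer if the right (equivalently, left) annihilator of every nonempty subset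 is generated, as a right (respectively left) ideal, by an idempotent. *)

(* Defs.v *)
From HB Require Import structures.
From mathcomp Require Import all_boot all_order all_algebra.
From mathcomp Require Import boolp classical_sets.

Set Implicit Arguments.
Unset Strict Implicit.
Unset Printing Implicit Defensive.

Import GRing.Theory.
Local Open Scope classical_set_scope.
Local Open Scope ring_scope.

(* Endomorphisms need not preserve 1, so [{rmorphism R -> R}] is too strong. *)
Definition ring_endo (R : pzRingType) (sigma : R -> R) : Prop :=
  {morph sigma : x y / x + y} /\ {morph sigma : x y / x * y}.

Definition skew_derivation (R : pzRingType) (sigma delta : R -> R) : Prop :=
  {morph delta : x y / x + y} /\
  forall r s : R, delta (r * s) = sigma r * delta s + delta r * s.

(* f_1^(a_1) \o ... \o f_n^(a_n), in this order; the f_i need not commute. *)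
Definition multi_iter (T : Type) (n : nat) (f : 'I_n -> T -> T)
    (a : {ffun 'I_n -> nat}) : T -> T :=
  \big[comp/id]_(i < n) iter (a i) (f i).

Definition lann (R : pzRingType) (S : set R) : set R :=
  [set r | forall s, S s -> r * s = 0].

Definition rann (R : pzRingType) (S : set R) : set R :=
  [set r | forall s, S s -> s * r = 0].

(* The condition on right annihilators is equivalent to its left counterpart;
   since R is unital, the right ideal generated by e is eR. *)
Definition Baer (R : pzRingType) : Prop :=
  forall S : set R, S !=set0 ->
    exists2 e : R, e * e = e & rann S = [set e * r | r in [set: R]].

Definition semicommutative_family (R : pzRingType) (n : nat)
    (sigma : 'I_n -> R -> R) : Prop :=
  forall a b : R, a * b = 0 ->
    forall alpha : {ffun 'I_n -> nat}, alpha != 0 ->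
      forall r : R, a * r * multi_iter sigma alpha b = 0.

(* Main.v *)
Require Import Defs.
From HB Require Import structures.
From mathcomp Require Import all_boot all_order all_algebra.
From mathcomp Require Import boolp classical_sets.

(** Why the theorem holds.  In a Baer ring, the elements [x] with [a * x = 0]
are those with [e * x = x], for a suitable idempotent [e] with [a * e = 0]; so
the whole statement reduces to how the maps act on idempotents.

Semicommutativity forces every [sigma i] to be trivial there.  First
[sigma i 1 = 1]: for the idempotent [c = sigma i 1], the relation
[c * (1 - c) = 0] yields [c = c * sigma i c = sigma i c], and injectivity gives
[1 = c].  For an arbitrary idempotent [e], the relations [e * (1 - e) = 0] and
[(1 - e) * e = 0] then yield [e = e * sigma i e = sigma i e]
([sigma_idempotent]), after which they say that [e] is central.  Hence the
Leibniz rule for [e * e = e] makes every [delta i] vanish on idempotents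
([delta_idempotent]).

Now let [a * b = 0], and choose [e] for [a], so that [a * e = 0] and
[b = e * b].  Since [e] is a constant both for [sigma i] and for [delta i],
[sigma i b] and [delta i b] are again of the form [e * x], hence killed by [a]
on the left, while applying [sigma i] or [delta i] to [a * e = 0] shows that
[sigma i a] and [delta i a] kill [e], hence [b].  The converse needed for the
first assertion is the same remark read backwards, using injectivity: if
[sigma i b = e * sigma i b = sigma i (e * b)], then [b = e * b]. *)

Set Implicit Arguments.
Unset Strict Implicit.
Unset Printing Implicit Defensive.

Import GRing.Theory.
Local Open Scope classical_set_scope.
Local Open Scope ring_scope.

(** The monoid laws are what removes the factors [id] from [multi_iter]. *)
HB.instance Definition _ (T : Type) :=
  Monoid.isLaw.Build (T -> T) id (@comp T T T)
    (fun f g h => erefl) (fun f => erefl) (fun f => erefl).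

Lemma multi_iter_unit (T : Type) (n : nat) (f : 'I_n -> T -> T) (i : 'I_n) :
  multi_iter f [ffun j => nat_of_bool (j == i)] = f i.
Proof.
transitivity (\big[comp/id]_(j < n | j == i) f j); last exact: big_pred1.
rewrite [RHS]big_mkcond; apply: eq_bigr => j _.
by rewrite ffunE; case: (j == i).
Qed.

(** Unit exponent vectors are nonzero, so semicommutativity of the family covers
each of its members. *)
Lemma semicommutative_single (R : pzRingType) (n : nat)
    (sigma : 'I_n -> R -> R) (i : 'I_n) (a b r : R) :
  semicommutative_family sigma -> a * b = 0 -> a * r * sigma i b = 0.
Proof.
move=> semi ab0.
rewrite -(multi_iter_unit sigma i); apply: semi => //.
by apply/eqP => /ffunP/(_ i); rewrite !ffunE eqxx.
Qed.

Lemma multi_iter_ind (T : Type) (n : nat) (f : 'I_n -> T -> T)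
    (P : (T -> T) -> Prop) (a : {ffun 'I_n -> nat}) :
  P id -> (forall g h, P g -> P h -> P (g \o h)) -> (forall i, P (f i)) ->
  P (multi_iter f a).
Proof.
move=> Pid Pcomp Pf; apply: big_ind => // i _.
elim: (a i) => [|k IHk]; first exact: Pid.
exact: Pcomp (Pf i) IHk.
Qed.

(** An idempotent generator of the right annihilator of [a] acts as a left
identity on it, so it turns [a * x = 0] into the fixed-point equation
[e * x = x]. *)
Lemma Baer_idempotent (R : pzRingType) (a : R) : Baer R ->
  exists e : R, [/\ e * e = e, a * e = 0 & forall x, a * x = 0 -> e * x = x].
Proof.
move=> /(_ [set a]) [|e ee eE]; first by exists a.
exists e; split=> // [|x ax0].
  have : rann [set a] e by rewrite eE; exists 1; rewrite ?mulr1.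
  exact.
have : rann [set a] x by move=> _ ->.
by rewrite eE => -[r _ <-]; rewrite mulrA ee.
Qed.

Lemma additive0 (R : pzRingType) (f : R -> R) : {morph f : x y / x + y} -> f 0 = 0.
Proof. by move=> fD; apply: (addrI (f 0)); rewrite -fD !addr0. Qed.

Lemma additiveB (R : pzRingType) (f : R -> R) :
  {morph f : x y / x + y} -> {morph f : x y / x - y}.
Proof. by move=> fD x y; apply: (addIr (f y)); rewrite -fD !subrK. Qed.

Section OneMap.

Variables (R : pzRingType) (s d : R -> R).
Hypotheses (s_endo : ring_endo s) (s_inj : injective s).
Hypothesis d_der : skew_derivation s d.
Hypothesis s_semi : forall a b r : R, a * b = 0 -> a * r * s b = 0.
Hypothesis R_Baer : Baer R.

Let sD : {morph s : x y / x + y} := s_endo.1.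
Let sM : {morph s : x y / x * y} := s_endo.2.
Let dD : {morph d : x y / x + y} := d_der.1.
Let dM (x y : R) : d (x * y) = s x * d y + d x * y := d_der.2 x y.

Let idemB (e : R) : e * e = e -> e * (1 - e) = 0.
Proof. by move=> ee; rewrite mulrBr mulr1 ee subrr. Qed.

Let Bidem (e : R) : e * e = e -> (1 - e) * e = 0.
Proof. by move=> ee; rewrite mulrBl mul1r ee subrr. Qed.

(** Endomorphisms are not assumed unital; this is where injectivity and
semicommutativity together force it. *)
Lemma sigma_one : s 1 = 1.
Proof.
apply: s_inj; have cc : s 1 * s 1 = s 1 by rewrite -sM mulr1.
have := s_semi 1 (idemB cc).
rewrite mulr1 (additiveB sD) mulrBr cc -sM mul1r.
by move/eqP; rewrite subr_eq0 => /eqP.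
Qed.

Lemma sigma_idempotent (e : R) : e * e = e -> s e = e.
Proof.
move=> ee; have := s_semi 1 (Bidem ee); have := s_semi 1 (idemB ee).
rewrite !mulr1 (additiveB sD) sigma_one mulrBr mulr1 mulrBl mul1r.
by move=> /eqP; rewrite subr_eq0 => /eqP <- /eqP; rewrite subr_eq0 => /eqP.
Qed.

Lemma idempotent_central (e : R) : e * e = e -> forall x, x * e = e * x.
Proof.
move=> ee x; have := s_semi x (Bidem ee); have := s_semi x (idemB ee).
rewrite (additiveB sD) sigma_one (sigma_idempotent ee).
rewrite mulrBr mulr1 !mulrBl mul1r.
by move=> /eqP; rewrite subr_eq0 => /eqP <- /eqP; rewrite subr_eq0 => /eqP.
Qed.

(** The Leibniz rule reads [d e = e * d e + e * d e]; multiplying it by [e]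
gives [e * d e = 0], so both summands vanish. *)
Lemma delta_idempotent (e : R) : e * e = e -> d e = 0.
Proof.
move=> ee; have := dM e e.
rewrite ee (sigma_idempotent ee) (idempotent_central ee) => de.
suff ede0 : e * d e = 0 by rewrite de ede0 addr0.
apply: (addrI (e * d e)); rewrite addr0.
by rewrite [RHS](congr1 ( *%R e) de) mulrDr mulrA ee.
Qed.

Lemma mul_sigma_eq0 (a b : R) : a * s b = 0 <-> a * b = 0.
Proof.
have [e [ee ae0 fix_e]] := Baer_idempotent a R_Baer.
split=> [asb0 | /fix_e <-].
  suff <- : e * b = b by rewrite mulrA ae0 mul0r.
  by apply: s_inj; rewrite sM (sigma_idempotent ee) fix_e.
by rewrite sM (sigma_idempotent ee) mulrA ae0 mul0r.
Qed.

Lemma mul_delta_eq0 (a b : R) : a * b = 0 -> a * d b = 0.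
Proof.
have [e [ee ae0 fix_e]] := Baer_idempotent a R_Baer => /fix_e <-.
rewrite dM (sigma_idempotent ee) (delta_idempotent ee) mul0r addr0.
by rewrite mulrA ae0 mul0r.
Qed.

Lemma sigma_mul_eq0 (a b : R) : a * b = 0 -> s a * b = 0.
Proof.
have [e [ee ae0 fix_e]] := Baer_idempotent a R_Baer => /fix_e <-.
by rewrite -{1}(sigma_idempotent ee) mulrA -sM ae0 (additive0 sD) mul0r.
Qed.

Lemma delta_mul_eq0 (a b : R) : a * b = 0 -> d a * b = 0.
Proof.
have [e [ee ae0 fix_e]] := Baer_idempotent a R_Baer => /fix_e <-.
have := dM a e; rewrite ae0 (additive0 dD) (delta_idempotent ee) mulr0 add0r.
by rewrite mulrA => <-; rewrite mul0r.
Qed.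

End OneMap.

Theorem proposition4p5 (R : pzRingType) (n : nat)
    (sigma delta : 'I_n -> R -> R)
    (sigma_endo : forall i, ring_endo (sigma i))
    (sigma_inj : forall i, injective (sigma i))
    (delta_der : forall i, skew_derivation (sigma i) (delta i))
    (sigma_semicomm : semicommutative_family sigma)
    (R_Baer : Baer R)
    (alpha beta : {ffun 'I_n -> nat}) (S : set R) (S_neq0 : S !=set0) :
  [/\ lann S = lann (multi_iter sigma alpha @` S),
      lann S `<=` lann (multi_iter delta beta @` S),
      forall i : 'I_n, sigma i @` lann S `<=` lann S
    & forall i : 'I_n, delta i @` lann S `<=` lann S].
Proof.
have semi1 i a b r := semicommutative_single (sigma := sigma)
  i (a := a) (b := b) r sigma_semicomm.
have sE i := mul_sigma_eq0 (sigma_endo i) (@sigma_inj i) (semi1 i) R_Baer.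
have dE i :=
  mul_delta_eq0 (sigma_endo i) (@sigma_inj i) (delta_der i) (semi1 i) R_Baer.
have saE a b : a * multi_iter sigma alpha b = 0 <-> a * b = 0.
  move: a b; apply: (@multi_iter_ind _ _ sigma
    (fun f => forall a b, a * f b = 0 <-> a * b = 0)) => // f g fE gE a b /=.
  exact: iff_trans (fE _ _) (gE _ _).
have dbE a b : a * b = 0 -> a * multi_iter delta beta b = 0.
  move: a b; apply: (@multi_iter_ind _ _ delta
    (fun f => forall a b, a * b = 0 -> a * f b = 0)) => // f g fE gE a b /gE.
  exact: fE.
split=> [| r rS _ [x Sx <-] | i _ [r rS <-] x Sx | i _ [r rS <-] x Sx].
- apply/seteqP; split=> r rS.
    by move=> _ [x Sx <-]; apply/saE/rS.
  by move=> x Sx; apply/saE/rS; exists x.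
- exact/dbE/rS.
- apply: sigma_mul_eq0 (sigma_endo i) (@sigma_inj i) (semi1 i) R_Baer _ _ _.
  exact: rS.
- apply: delta_mul_eq0 (sigma_endo i) (@sigma_inj i) (delta_der i) (semi1 i)
    R_Baer _ _ _.
  exact: rS.
Qed.
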